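(* Let $(E,T,S,e)$ be a $T$-conditionally ergodic conditional expectation preserving system, where $T$ is strictly positive, $E$ is $T$-universally complete and $S$ is surjective. For each component $p$ of $e$ we have $$T n_p=P_{Tp}\,e .$$
   Context: A conditional expectation on a Riesz space $E$ with weak order unit is a positive order continuous (linear) projection $T:E\to E$ whose range $R(T)$ is a Dedekind complete Riesz subspace of $E$ and such that $Te$ is a weak order unit of $E$ for each weak order unit $e$ of $E$. A conditional expectation preserving system is a 4-tuple $(E,T,S,e)$ where $E$ is a Dedekind complete Riesz space, $e$ is a weak order unit of $E$, $T$ is a conditional expectation on $E$ with $Te=e$, and $S$ is an order continuous Riesz homomorphism on $E$ with $Se=e$ and $TS=T$. The system is ($T$-)conditionally ergodic if $\mathcal{I}_S:=\{f\in E : Sf=f\}\subset R(T)$. $T$ is strictly positive if $f\in E$, $f\ge 0$ and $Tf=0$ imply $f=0$ (in this case $S$ is injective, so a surjective $S$ is bijective). $E$ is $T$-universally complete if for each increasing net $(f_\alpha)$ in $E_+$ with $(Tf_\alpha)$ order bounded, $(f_\alpha)$ is order convergent in $E$. For $q\in E_+$, $p\in E$ is a component of $q$ if $0\le p\le q$ and $p\wedge(q-p)=0$. For $f\in E_+$, $P_f$ denotes the band projection of $E$ onto the band generated by $f$. First recurrence time: for $S$ bijective and $p$ a component of $e$, put $N_p(0)=p$ and, for $n\ge 1$, $$N_p(n)=\bigvee\{q : q \text{ a component of } p,\ p\wedge S^jq=0 \text{ for all } j=1,\dots,n\},$$ and define $$n_p=\sum_{k=1}^\infty k\,(N_p(k-1)-N_p(k)),$$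 the sum being the supremum of its partial sums, a priori an element of the positive cone of the universal completion $E_u$ of $E$ (the $N_p(k-1)-N_p(k)$ are disjoint components of $e$). Under the hypotheses of the claim $n_p\in E$. *)

(* Defs.v *)
From HB Require Import structures.
From mathcomp Require Import all_boot all_order all_algebra.
From mathcomp Require Import boolp classical_sets reals.

Set Implicit Arguments.
Unset Strict Implicit.
Unset Printing Implicit Defensive.

Import Order.TTheory GRing.Theory Num.Theory.

Local Open Scope classical_set_scope.
Local Open Scope ring_scope.

(* The least upper bound and greatest lower bound operations are fields of this
   mixin, rather than coming from Order.Lattice, because no structure joining
   Zmodule and Lattice exists below Num.RealDomain and one cannot be inserted
   afterwards. The axioms determine both operations. *)
HB.mixin Record isRiesz (R : numDomainType) E
    of GRing.Lmodule R E & Num.POrderedZmodule E := {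
  riesz_join : E -> E -> E ;
  riesz_meet : E -> E -> E ;
  riesz_leUx : forall x y z : E, (riesz_join x y <= z) = (x <= z) && (y <= z) ;
  riesz_lexI : forall x y z : E, (z <= riesz_meet x y) = (z <= x) && (z <= y) ;
  riesz_leD2l : forall x y z : E, x <= y -> z + x <= z + y ;
  riesz_leZ2l : forall (a : R) (x y : E), 0 <= a -> x <= y -> a *: x <= a *: y
}.

#[short(type="rieszType")]
HB.structure Definition Riesz (R : numDomainType) :=
  { E of GRing.Lmodule R E & Num.POrderedZmodule E & isRiesz R E }.

Notation "x '\vee' y" := (riesz_join x y)
  (at level 50, left associativity) : ring_scope.
Notation "x '\wedge' y" := (riesz_meet x y)
  (at level 48, left associativity) : ring_scope.

Section RieszDefs.
Context {R : realType} {E : rieszType R}.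
Implicit Types (A B F : set E) (f g x y p q e : E) (T S : {linear E -> E}).

Definition riesz_abs x : E := x \vee - x.

Definition dedekind_complete : Prop :=
  forall A, has_sup A -> supremums A !=set0.

Definition riesz_subspace F : Prop :=
  [/\ F 0,
      forall x y, F x -> F y -> F (x + y),
      forall (a : R) x, F x -> F (a *: x),
      forall x y, F x -> F y -> F (x \vee y)
    & forall x y, F x -> F y -> F (x \wedge y)].

(* Bounds and suprema are taken inside F, for the order induced by E; they need
   not agree with suprema in E. *)
Definition dedekind_complete_subspace F : Prop :=
  riesz_subspace F /\
  forall A, A `<=` F -> A !=set0 -> F `&` ubound A !=set0 ->
    exists s, [/\ F s, ubound A s & forall u, F u -> ubound A u -> s <= u].

Definition riesz_ideal B : Prop :=
  [/\ B 0,
      forall x y, B x -> B y -> B (x + y),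
      forall (a : R) x, B x -> B (a *: x)
    & forall x y, B y -> riesz_abs x <= riesz_abs y -> B x].

Definition band B : Prop :=
  riesz_ideal B /\ forall A s, A `<=` B -> supremums A s -> B s.

Definition band_gen f : set E :=
  [set x | forall B, band B -> B f -> B x].

Definition disjoint_compl B : set E :=
  [set x | forall y, B y -> riesz_abs x \wedge riesz_abs y = 0].

(* The value at g is the B-part of the decomposition of g along the direct sum
   of B := band_gen f and its disjoint complement. Such a decomposition exists
   and is unique when E is Dedekind complete; the default 0 is otherwise
   irrelevant. *)
Definition band_proj f g : E :=
  xget 0 [set h | band_gen f h /\ disjoint_compl (band_gen f) (g - h)].

Definition weak_order_unit e : Prop := 0 <= e /\ band_gen e = setT.

Definition component q p : Prop := 0 <= p <= q /\ p \wedge (q - p) = 0.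

Definition directed (I : Type) (le : I -> I -> Prop) : Prop :=
  [/\ inhabited I,
      forall i, le i i,
      forall i j k, le i j -> le j k -> le i k
    & forall i j, exists k, le i k /\ le j k].

Definition increasing_net (I : Type) (le : I -> I -> Prop) (u : I -> E) : Prop :=
  forall i j, le i j -> u i <= u j.

Definition decreasing_net (I : Type) (le : I -> I -> Prop) (u : I -> E) : Prop :=
  forall i j, le i j -> u j <= u i.

Definition order_cvg (I : Type) (le : I -> I -> Prop) (u : I -> E) (l : E) : Prop :=
  exists v : I -> E, [/\ decreasing_net le v, infimums (range v) 0
    & forall i, riesz_abs (u i - l) <= v i].

Definition order_continuous (L : E -> E) : Prop :=
  forall (I : Type) (le : I -> I -> Prop) (u : I -> E) (l : E),
    directed le -> order_cvg le u l -> order_cvg le (L \o u) (L l).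

Definition riesz_hom S : Prop :=
  (forall x y, S (x \vee y) = S x \vee S y) /\
  (forall x y, S (x \wedge y) = S x \wedge S y).

Definition conditional_expectation T : Prop :=
  [/\ forall f, 0 <= f -> 0 <= T f,
      order_continuous T,
      forall f, T (T f) = T f,
      dedekind_complete_subspace (range T)
    & forall w, weak_order_unit w -> weak_order_unit (T w)].

Record cond_exp_preserving_system T S e : Prop := {
  ceps_complete : dedekind_complete ;
  ceps_unit : weak_order_unit e ;
  ceps_condexp : conditional_expectation T ;
  ceps_Te : T e = e ;
  ceps_Scont : order_continuous S ;
  ceps_Shom : riesz_hom S ;
  ceps_Se : S e = e ;
  ceps_TS : forall f, T (S f) = T f
}.

Definition invariants S : set E := [set f | S f = f].

Definition conditionally_ergodic T S : Prop := invariants S `<=` range T.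

Definition strictly_positive T : Prop := forall f, 0 <= f -> T f = 0 -> f = 0.

Definition T_universally_complete T : Prop :=
  forall (I : Type) (le : I -> I -> Prop) (u : I -> E),
    directed le -> increasing_net le u -> (forall i, 0 <= u i) ->
    has_ubound (range (T \o u)) -> exists l, order_cvg le u l.

Definition no_return S p (n : nat) : E :=
  if n is 0%N then p else
  supremum 0 [set q | component p q /\
    forall j, (1 <= j <= n)%N -> p \wedge iter j S q = 0].

Definition recurrence_partial S p (m : nat) : E :=
  \sum_(1 <= k < m.+1) (no_return S p k.-1 - no_return S p k) *+ k.

(* A supremum taken in E, with the default 0 if it does not exist there. E is an
   order dense subspace of its universal completion, so a supremum that exists
   in E is also the supremum in the completion. *)
Definition first_recurrence S p : E :=
  supremum 0 (range (recurrence_partial S p)).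

End RieszDefs.

Arguments dedekind_complete {R} E.

(* Main.v *)
Require Import Defs.
From mathcomp Require Import all_boot all_order all_algebra.
From mathcomp Require Import boolp classical_sets reals.

Set Implicit Arguments.
Unset Strict Implicit.
Unset Printing Implicit Defensive.

Import Order.TTheory GRing.Theory Num.Theory.

Local Open Scope classical_set_scope.
Local Open Scope ring_scope.

(** Read in a space of functions, [p] is the indicator of a set [A], [S] is
    composition with an invertible transformation [s], and [n_p] is the time of
    the first return to [A]. The claim is Kac's formula: the conditional mean of
    this time is one wherever the conditional probability of [A] is positive.

    Let [N n] be the part of [p] that does not return up to time [n]. Summing by
    parts, the partial sum of order [m] of the series of [n_p] is
    [N 0 + ... + N (m-1) - N m *+ m]. Now [S^n (N n)] is exactly the part of
    [S^n p] that is disjoint from [p, S p, ..., S^(n-1) p]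
    ([no_returnP]), and these pieces for [n < m] add up to the join [U_m] of
    [S^i p], [i < m]. As [T] is insensitive to [S], it follows that
    [T (N 0 + ... + N (m-1)) = T U_m <= e] ([condexp_no_return_sum]).
    Universal completeness then provides the supremum [a] of the sums
    [N 0 + ... + N (m-1)], and order continuity gives [T a = T U], where [U] is
    the supremum of the [U_m].

    The correction [N m *+ m] does not affect the supremum
    ([sup_recurrence_partial]), so that [a = n_p].

    It remains to identify [T U] with the projection of [e]
    ([sup_visited_band_proj]). Surjectivity gives [S U <= U], and [T] kills
    [U - S U], so [U] is invariant; by ergodicity [T U = U]. Since [p <= U], the
    element [T p] lies below [U], hence is disjoint from [e - U]. Conversely let
    [w] be the supremum of [T p *+ n \wedge e]. It is a component of [e] with
    [T w = w], and strict positivity of [T] turns disjointness of images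
    under [T] into disjointness: this shows first [p <= w] and then [S w <= w],
    whence [U <= w], which lies in the band generated by [T p]. *)

(** * Riesz spaces: lattice operations, disjointness and bands *)

Section VectorLattice.
Context {R : realType} {E : rieszType R}.
Implicit Types (x y z t a b d u v e : E) (A : set E).

Lemma riesz_leD2lE z x y : (z + x <= z + y) = (x <= y).
Proof.
apply/idP/idP => [h|]; last exact: riesz_leD2l.
by have := riesz_leD2l _ _ (- z) h; rewrite !addKr.
Qed.

Lemma riesz_leBlDr x y z : (x - y <= z) = (x <= z + y).
Proof. by rewrite -[LHS](riesz_leD2lE y) addrCA subrr addr0 [y + z]addrC. Qed.

Lemma riesz_leBrDr x y z : (x <= y - z) = (x + z <= y).
Proof.
by rewrite -[LHS](riesz_leD2lE z) [z + (y - z)]addrCA subrr addr0 [z + x]addrC.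
Qed.

Lemma riesz_subr_ge0 x y : (0 <= y - x) = (x <= y).
Proof. by rewrite riesz_leBrDr add0r. Qed.

Lemma riesz_leD x y z t : x <= y -> z <= t -> x + z <= y + t.
Proof.
move=> xy zt; apply: (@le_trans _ _ (x + t)); first by rewrite riesz_leD2lE.
by rewrite ![_ + t]addrC riesz_leD2lE.
Qed.

Lemma riesz_lerDl x y : 0 <= y -> x <= x + y.
Proof. by move=> y0; rewrite -{1}[x]addr0 riesz_leD2lE. Qed.

Lemma riesz_leN2 x y : (- x <= - y) = (y <= x).
Proof. by rewrite -[LHS](riesz_leD2lE x) subrr riesz_subr_ge0. Qed.

Lemma riesz_lerMn x y n : x <= y -> x *+ n <= y *+ n.
Proof.
move=> xy; elim: n => [|n ih]; first by rewrite !mulr0n.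
by rewrite !mulrS riesz_leD.
Qed.

Lemma riesz_mulrn_ge0 x n : 0 <= x -> 0 <= x *+ n.
Proof. by move=> x0; rewrite -(mul0rn E n) riesz_lerMn. Qed.

Lemma leIl_riesz x y : x \wedge y <= x.
Proof. by have := lexx (x \wedge y); rewrite {1}riesz_lexI => /andP[]. Qed.

Lemma leIr_riesz x y : x \wedge y <= y.
Proof. by have := lexx (x \wedge y); rewrite {1}riesz_lexI => /andP[]. Qed.

Lemma leUl_riesz x y : x <= x \vee y.
Proof. by have := lexx (x \vee y); rewrite {1}riesz_leUx => /andP[]. Qed.

Lemma leUr_riesz x y : y <= x \vee y.
Proof. by have := lexx (x \vee y); rewrite {1}riesz_leUx => /andP[]. Qed.

Lemma riesz_meetC x y : x \wedge y = y \wedge x.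
Proof. by apply/le_anti; rewrite !riesz_lexI !leIl_riesz !leIr_riesz. Qed.

Lemma riesz_leI2 x y z t : x <= y -> z <= t -> x \wedge z <= y \wedge t.
Proof.
move=> xy zt; rewrite riesz_lexI (le_trans (leIl_riesz _ _) xy).
exact: le_trans (leIr_riesz _ _) zt.
Qed.

Lemma riesz_meet_ge0 x y : 0 <= x -> 0 <= y -> 0 <= x \wedge y.
Proof. by rewrite riesz_lexI => -> ->. Qed.

Lemma riesz_meet_idPl x y : x \wedge y = x <-> x <= y.
Proof.
split=> [<-|xy]; first exact: leIr_riesz.
by apply/le_anti; rewrite leIl_riesz riesz_lexI lexx.
Qed.

Lemma riesz_meet_eq0W x y z t :
  0 <= x -> 0 <= z -> x <= y -> z <= t -> y \wedge t = 0 -> x \wedge z = 0.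
Proof.
move=> x0 z0 xy zt yt; apply/le_anti; rewrite riesz_meet_ge0 // andbT -yt.
exact: riesz_leI2.
Qed.

(** Both inequalities translate to a bound on one argument at a time: for
    instance [x + y - x \vee y] lies below [x] because [y <= x \vee y]. *)
Lemma riesz_joinDmeet x y : x \vee y + x \wedge y = x + y.
Proof.
apply/le_anti/andP; split.
  rewrite -riesz_leBrDr riesz_leUx !riesz_leBrDr riesz_leD2lE leIr_riesz /=.
  by rewrite [y + _]addrC [x + y]addrC [_ + y]addrC riesz_leD2lE leIl_riesz.
rewrite [X in _ <= X]addrC -riesz_leBlDr riesz_lexI !riesz_leBlDr.
by rewrite riesz_leD2lE leUr_riesz [x + y]addrC riesz_leD2lE leUl_riesz.
Qed.

Lemma riesz_disjoint_leB x y e :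
  x \wedge y = 0 -> x <= e -> y <= e -> x <= e - y.
Proof.
move=> xy0 xe ye; rewrite riesz_leBrDr -riesz_joinDmeet xy0 addr0.
by rewrite riesz_leUx xe.
Qed.

(** Infinite distributivity. Modularity writes each element of [A] as
    [a \vee d + a \wedge d - d], hence below [s \vee d + b - d]; the latter
    then bounds [s], and modularity read backwards gives the claim. *)
Lemma riesz_sup_meet_le A s d b : supremums A s ->
  (forall a, A a -> a \wedge d <= b) -> s \wedge d <= b.
Proof.
move=> [ubs lubs] Ab.
have : s <= s \vee d + b - d.
  apply: lubs => a Aa; rewrite riesz_leBrDr -riesz_joinDmeet.
  apply: riesz_leD; last exact: Ab.
  by rewrite riesz_leUx leUr_riesz (le_trans (ubs _ Aa)) ?leUl_riesz.
by rewrite riesz_leBrDr -riesz_joinDmeet riesz_leD2lE.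
Qed.

Lemma riesz_join_meet_le x y d b :
  x \wedge d <= b -> y \wedge d <= b -> (x \vee y) \wedge d <= b.
Proof.
move=> xb yb; apply: (@riesz_sup_meet_le [set x; y]).
  split=> [z [->|->]|z ub]; [exact: leUl_riesz|exact: leUr_riesz|].
  by rewrite riesz_leUx !ub //; [right|left].
by move=> z [->|->].
Qed.

Lemma riesz_meetD_le u v d : 0 <= u -> 0 <= v -> 0 <= d ->
  (u + v) \wedge d <= u \wedge d + v \wedge d.
Proof.
move=> u0 v0 d0; rewrite -riesz_leBlDr riesz_lexI !riesz_leBlDr.
apply/andP; split; last first.
  by rewrite (le_trans (leIr_riesz _ _)) // riesz_lerDl ?riesz_meet_ge0.
rewrite [u + v \wedge d]addrC -riesz_leBlDr riesz_lexI !riesz_leBlDr.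
rewrite [v + u]addrC leIl_riesz /=.
by rewrite (le_trans (leIr_riesz _ _)) // riesz_lerDl.
Qed.

Lemma riesz_meetMn_eq0 x d n : 0 <= x -> 0 <= d ->
  x \wedge d = 0 -> (x *+ n) \wedge d = 0.
Proof.
move=> x0 d0 xd; elim: n => [|n ih].
  by rewrite mulr0n; apply/riesz_meet_idPl.
apply/le_anti; rewrite riesz_meet_ge0 ?riesz_mulrn_ge0 // andbT mulrS.
rewrite (le_trans (riesz_meetD_le _ _ _)) ?riesz_mulrn_ge0 //.
by rewrite xd ih addr0.
Qed.

Lemma riesz_ler_abs x : x <= riesz_abs x.
Proof. exact: leUl_riesz. Qed.

Lemma riesz_lerN_abs x : - x <= riesz_abs x.
Proof. exact: leUr_riesz. Qed.

Lemma riesz_abs_le x b : x <= b -> - x <= b -> riesz_abs x <= b.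
Proof. by rewrite /riesz_abs riesz_leUx => -> ->. Qed.

Lemma riesz_abs_ge0 x : 0 <= riesz_abs x.
Proof.
have h2 : 0 <= riesz_abs x + riesz_abs x.
  by rewrite -(subrr x) riesz_leD ?riesz_ler_abs ?riesz_lerN_abs.
have := @riesz_leZ2l _ E 2^-1 _ _ _ h2.
rewrite scaler0 -mulr2n -scaler_nat scalerA mulVf ?pnatr_eq0 // scale1r.
by apply; rewrite invr_ge0.
Qed.

Lemma riesz_ger0_abs x : 0 <= x -> riesz_abs x = x.
Proof.
move=> x0; apply/le_anti; rewrite riesz_ler_abs riesz_abs_le //.
by rewrite (le_trans _ x0) // -oppr0 riesz_leN2.
Qed.

Lemma riesz_abs_eq0 x : riesz_abs x = 0 -> x = 0.
Proof.
move=> x0; apply/le_anti.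
by rewrite -{1}x0 riesz_ler_abs -riesz_leN2 oppr0 -x0 riesz_lerN_abs.
Qed.

Lemma riesz_absD_le x y : riesz_abs (x + y) <= riesz_abs x + riesz_abs y.
Proof.
apply: riesz_abs_le; first by rewrite riesz_leD ?riesz_ler_abs.
by rewrite opprD riesz_leD ?riesz_lerN_abs.
Qed.

Lemma riesz_leZ_abs (c : R) x : c *: x <= `|c| *: riesz_abs x.
Proof.
have [c0|c0] := leP 0 c.
  by rewrite ger0_norm // riesz_leZ2l // riesz_ler_abs.
rewrite ltr0_norm // -[X in X <= _]opprK -scalerN -scaleNr.
by apply: riesz_leZ2l; [rewrite oppr_ge0 ltW|exact: riesz_lerN_abs].
Qed.

Lemma riesz_absZ_le (c : R) x : riesz_abs (c *: x) <= `|c| *: riesz_abs x.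
Proof.
apply: riesz_abs_le; first exact: riesz_leZ_abs.
by rewrite -scaleNr -normrN riesz_leZ_abs.
Qed.

Lemma riesz_meetZ_eq0 (c : R) x d : 0 <= c -> 0 <= x -> 0 <= d ->
  x \wedge d = 0 -> (c *: x) \wedge d = 0.
Proof.
move=> c0 x0 d0 xd.
have cx0 : 0 <= c *: x by rewrite -(scaler0 _ c) riesz_leZ2l.
pose n := (Num.truncn c).+1.
apply: (@riesz_meet_eq0W _ (x *+ n) _ d) => //.
  rewrite -scaler_nat -riesz_subr_ge0 -scalerBl -(scaler0 _ (n%:R - c)).
  by rewrite riesz_leZ2l // subr_ge0 ltW // truncnS_gt.
exact: riesz_meetMn_eq0.
Qed.

(** The disjoint complement of a single element is a band; for suprema this is
    infinite distributivity applied to the positive part, the negative part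
    being dominated by that of any member. *)
Lemma riesz_disjoint_band d : 0 <= d ->
  band [set x | riesz_abs x \wedge d = 0].
Proof.
move=> d0; split; first split=> /=.
- rewrite riesz_ger0_abs //; exact/riesz_meet_idPl.
- move=> x y xd yd; apply/le_anti.
  rewrite riesz_meet_ge0 ?riesz_abs_ge0 // andbT.
  rewrite (le_trans (riesz_leI2 (riesz_absD_le x y) (lexx d))) //.
  by rewrite (le_trans (riesz_meetD_le _ _ _)) ?riesz_abs_ge0 // xd yd addr0.
- move=> c x xd.
  apply: (riesz_meet_eq0W _ _ (riesz_absZ_le c x) (lexx d));
    rewrite ?riesz_abs_ge0 //.
  by rewrite riesz_meetZ_eq0 ?riesz_abs_ge0.
- move=> x y yd xy.
  exact: (riesz_meet_eq0W (riesz_abs_ge0 _) d0 xy (lexx d)).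
move=> A s /= Ad supA; apply/le_anti.
rewrite riesz_meet_ge0 ?riesz_abs_ge0 // andbT.
apply: riesz_join_meet_le.
  apply: (riesz_sup_meet_le supA) => a Aa; rewrite -(Ad _ Aa).
  exact: riesz_leI2 (riesz_ler_abs a) (lexx d).
have [[a Aa]|A0] := pselect (A !=set0).
  rewrite -(Ad _ Aa); apply: riesz_leI2 => //.
  by rewrite (le_trans _ (riesz_lerN_abs a)) // riesz_leN2 (proj1 supA).
(* The supremum of the empty set is a least element. *)
have s0 : 0 <= s.
  rewrite -(riesz_leD2lE s) addr0; apply: (proj2 supA) => a Aa.
  by case: A0; exists a.
by rewrite (le_trans (leIl_riesz _ _)) // -oppr0 riesz_leN2.
Qed.

Lemma riesz_band_gen_disjoint x d y : 0 <= x -> 0 <= d -> x \wedge d = 0 ->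
  band_gen x y -> riesz_abs d \wedge riesz_abs y = 0.
Proof.
move=> x0 d0 xd xy; rewrite riesz_meetC (riesz_ger0_abs d0).
by apply: (xy _ (riesz_disjoint_band d0)); rewrite /= riesz_ger0_abs.
Qed.

(** A decomposition along a band and its disjoint complement is unique: the
    difference [h - k] of two candidates lies in the band, and is disjoint from
    it as the difference of [g - k] and [g - h]. *)
Lemma band_proj_eq (f g h : E) : band_gen f h ->
  disjoint_compl (band_gen f) (g - h) -> band_proj f g = h.
Proof.
move=> fh gh; rewrite /band_proj; case: xgetP; last first.
  by move=> /(_ h)[]; split.
move=> k _ [fk gk].
apply/esym/subr0_eq/riesz_abs_eq0; set y := h - k.
have fy : band_gen f y.
  move=> B bB Bf; have [[_ BD BZ _] _] := bB.
  by apply: BD; [exact: fh|rewrite -scaleN1r; apply: BZ; exact: fk].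
have [[_ DD DZ _] _] := riesz_disjoint_band (riesz_abs_ge0 y).
have : riesz_abs y \wedge riesz_abs y = 0.
  have {1}-> : y = (g - k) + (-1) *: (g - h).
    by rewrite scaleN1r opprB addrC addrA subrK.
  by apply: DD; [exact: gk|apply: DZ; exact: gh].
by rewrite (proj2 (riesz_meet_idPl _ _)).
Qed.

End VectorLattice.

(** * Suprema and order convergence of sequences *)

Section OrderConvergence.
Context {R : realType} {E : rieszType R}.
Implicit Types (x y s l w : E) (A : set E) (u : nat -> E).

Let le_nat (m n : nat) : Prop := (m <= n)%N.

Lemma supremum_eq (x0 : E) A s : A !=set0 -> supremums A s -> supremum x0 A = s.
Proof.
move=> [a Aa] As; rewrite /supremum; case: eqP => [A0|_].
  by move: Aa; rewrite A0.
by case: xgetP => [t _ At|/(_ s)//]; apply: is_subset1_supremums At As.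
Qed.

Lemma supremum_max (x0 : E) A s : A s -> ubound A s -> supremum x0 A = s.
Proof.
by move=> As ubs; apply: supremum_eq; [exists s|split=> // t ubt; apply: ubt].
Qed.

(** If all multiples of [x] have a supremum, it absorbs one more [x]. *)
Lemma riesz_archimedean x y : dedekind_complete E ->
  (forall n, x *+ n <= y) -> x <= 0.
Proof.
move=> dc xy; have [|s [ubs lubs]] := dc (range (fun n => x *+ n)).
  by split; [exists 0, 0%N|exists y => _ [n _ <-]].
have : s <= s - x.
  apply: lubs => _ [n _ <-]; rewrite riesz_leBrDr -mulrSr.
  by apply: ubs; exists n.+1.
by rewrite riesz_leBrDr -{2}[s]addr0 riesz_leD2lE.
Qed.

Lemma directed_nat : directed le_nat.
Proof.
split=> [|i|i j k|i j]; rewrite /le_nat //; first exact: (inhabits 0%N).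
  by move=> ij jk; exact: leq_trans ij jk.
by exists (maxn i j); rewrite leq_maxl leq_maxr.
Qed.

Lemma increasing_netS u : (forall n, u n <= u n.+1) -> increasing_net le_nat u.
Proof.
move=> uS i j /subnKC <-; elim: (j - i)%N => [|k ih]; first by rewrite addn0.
by rewrite addnS (le_trans ih).
Qed.

(** For [i] beyond [k] the bound [v k] is reached from [v i], as [v] decreases;
    for [i] before [k] it is reached from [u i <= u k]. *)
Lemma order_cvg_sup u l : increasing_net le_nat u -> order_cvg le_nat u l ->
  supremums (range u) l.
Proof.
move=> uinc [v [vdec [_ glb0] uv]]; split=> [_ [i _ <-]|b ubb].
  rewrite -[l]add0r -riesz_leBlDr; apply: glb0 => _ [k _ <-].
  have [ik|/ltnW ki] := leqP i k.
    apply: le_trans (uv k); apply: le_trans (riesz_ler_abs _).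
    by rewrite ![_ - l]addrC riesz_leD2lE uinc.
  exact: le_trans (riesz_ler_abs _) (le_trans (uv i) (vdec _ _ ki)).
rewrite -[b]add0r -riesz_leBlDr; apply: glb0 => _ [k _ <-].
apply: le_trans (uv k); apply: le_trans (riesz_lerN_abs _).
by rewrite opprB riesz_leD2lE riesz_leN2; apply: ubb; exists k.
Qed.

Lemma sup_order_cvg u l : increasing_net le_nat u -> supremums (range u) l ->
  order_cvg le_nat u l.
Proof.
move=> uinc [ubl lubl]; exists (fun n => l - u n).
have ul n : u n <= l by apply: ubl; exists n.
split=> [i j ij||i].
- by rewrite riesz_leD2lE riesz_leN2 uinc.
- split=> [_ [i _ <-]|y lby]; first by rewrite riesz_subr_ge0.
  have : l <= l - y.
    apply: lubl => _ [i _ <-].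
    by rewrite riesz_leBrDr addrC -riesz_leBrDr; apply: lby; exists i.
  by rewrite riesz_leBrDr -{2}[l]addr0 riesz_leD2lE.
apply: riesz_abs_le; last by rewrite opprB.
by apply: (@le_trans _ _ 0); rewrite ?riesz_subr_ge0 // riesz_leBlDr add0r.
Qed.

Lemma positive_le (T : {linear E -> E}) : (forall x, 0 <= x -> 0 <= T x) ->
  forall x y, x <= y -> T x <= T y.
Proof.
by move=> Tpos x y xy; rewrite -riesz_subr_ge0 -raddfB Tpos // riesz_subr_ge0.
Qed.

Lemma order_continuous_sup (T : {linear E -> E}) u l :
  (forall x, 0 <= x -> 0 <= T x) -> order_continuous T ->
  (forall n, u n <= u n.+1) -> supremums (range u) l ->
  supremums (range (T \o u)) (T l).
Proof.
move=> Tpos Tc uS ul; apply: order_cvg_sup.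
  by apply: increasing_netS => n; apply: positive_le.
by apply: Tc directed_nat _; apply: sup_order_cvg => //; exact: increasing_netS.
Qed.

(** [x *+ n \wedge e] increases to the projection [w] of [e] onto the band
    generated by [x]. The part of [x] under [e - w] can be added to every term
    of the sequence, so it vanishes. *)
Lemma sup_meet_unit_component x e w : 0 <= x -> 0 <= e ->
  supremums (range (fun n => x *+ n \wedge e)) w ->
  [/\ x \wedge (e - w) = 0, w \wedge (e - w) = 0 & 0 <= w <= e].
Proof.
move=> x0 e0 supw; have [ubw lubw] := supw.
have we : w <= e by apply: lubw => _ [n _ <-]; exact: leIr_riesz.
have ew0 : 0 <= e - w by rewrite riesz_subr_ge0.
have w0 : 0 <= w.
  by apply: ubw; exists 0%N => //; rewrite mulr0n; apply/riesz_meet_idPl.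
have xw : x \wedge (e - w) = 0.
  apply/le_anti; rewrite riesz_meet_ge0 // andbT.
  rewrite -(riesz_leD2lE w) addr0 -riesz_leBrDr.
  apply: lubw => _ [n _ <-]; rewrite riesz_leBrDr.
  apply: (@le_trans _ _ (x *+ n.+1 \wedge e)); last by apply: ubw; exists n.+1.
  rewrite riesz_lexI; apply/andP; split.
    by rewrite mulrSr riesz_leD ?leIl_riesz.
  rewrite -[X in _ <= X](subrKC w) riesz_leD ?leIr_riesz //.
  by apply: ubw; exists n.
split=> //; last by rewrite w0.
apply/le_anti; rewrite riesz_meet_ge0 // andbT.
apply: (riesz_sup_meet_le supw) => _ [n _ <-].
rewrite -(riesz_meetMn_eq0 n x0 ew0 xw).
exact: riesz_leI2 (leIl_riesz _ _) (lexx _).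
Qed.

Lemma band_gen_le x e w v :
  0 <= x -> supremums (range (fun n => x *+ n \wedge e)) w ->
  0 <= e -> 0 <= v <= w -> band_gen x v.
Proof.
move=> x0 supw e0 /andP[v0 vw] B [[B0 BD BZ BI] Bs] Bx.
have Bw : B w.
  apply: Bs supw => _ [n _ <-]; apply: (BI _ (x *+ n)).
    by rewrite -scaler_nat; exact: BZ.
  rewrite !riesz_ger0_abs ?riesz_meet_ge0 ?riesz_mulrn_ge0 //.
  exact: leIl_riesz.
by apply: BI Bw _; rewrite !riesz_ger0_abs // (le_trans v0).
Qed.

End OrderConvergence.

(** * Recurrence under the shift *)

Section Recurrence.
Context {R : realType} {E : rieszType R} (T S : {linear E -> E}) (e : E).
Context (sys : cond_exp_preserving_system T S e) (Tpos : strictly_positive T).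
Context (Ssurj : forall y : E, exists x : E, S x = y).
Implicit Types (x y q : E).

Lemma condexp_ge0 x : 0 <= x -> 0 <= T x.
Proof. by case: (ceps_condexp sys) => + _ _ _ _; exact. Qed.

Lemma condexp_le x y : x <= y -> T x <= T y.
Proof. exact/positive_le/condexp_ge0. Qed.

Lemma unit_ge0 : 0 <= e.
Proof. by case: (ceps_unit sys). Qed.

(** The meet of [x] and [y] has an expectation below those of both, hence zero
    expectation, and strict positivity applies. *)
Lemma condexp_disjoint x y : 0 <= x -> 0 <= y ->
  T x \wedge T y = 0 -> x \wedge y = 0.
Proof.
move=> x0 y0 Txy; have xy0 := riesz_meet_ge0 x0 y0.
apply: Tpos => //; apply/le_anti; rewrite condexp_ge0 // andbT -Txy.
by rewrite riesz_lexI !condexp_le ?leIl_riesz ?leIr_riesz.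
Qed.

(** Injectivity of the shift comes from the expectation: [S x = 0] forces
    [S |x| = 0], and [T] does not distinguish [S |x|] from [|x|]. *)
Lemma shift_eq0 x : S x = 0 -> x = 0.
Proof.
move=> Sx0; apply/riesz_abs_eq0/Tpos; first exact: riesz_abs_ge0.
have [SU _] := ceps_Shom sys.
rewrite -(ceps_TS sys) SU raddfN /= Sx0 oppr0.
suff -> : (0 : E) \vee 0 = 0 by rewrite raddf0.
by apply/le_anti; rewrite leUl_riesz riesz_leUx lexx.
Qed.

Lemma shift_inj x y : S x = S y -> x = y.
Proof.
by move=> Sxy; apply/subr0_eq/shift_eq0; rewrite raddfB /= Sxy subrr.
Qed.

Lemma shift_leE x y : (S x <= S y) = (x <= y).
Proof.
have [_ SI] := ceps_Shom sys.
apply/idP/idP; last first.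
  by move=> /riesz_meet_idPl xy; apply/riesz_meet_idPl; rewrite -SI xy.
move=> /riesz_meet_idPl; rewrite -SI => /shift_inj xy.
exact/riesz_meet_idPl.
Qed.

Lemma iter_shiftI n x y : iter n S (x \wedge y) = iter n S x \wedge iter n S y.
Proof. by elim: n => //= n ->; rewrite (proj2 (ceps_Shom sys)). Qed.

Lemma iter_shiftB n x y : iter n S (x - y) = iter n S x - iter n S y.
Proof. by elim: n => //= n ->; rewrite raddfB. Qed.

Lemma iter_shift0 n : iter n S 0 = 0.
Proof. by elim: n => //= n ->; rewrite raddf0. Qed.

Lemma iter_shift_unit n : iter n S e = e.
Proof. by elim: n => //= n ->; rewrite (ceps_Se sys). Qed.

Lemma iter_shift_leE n x y : (iter n S x <= iter n S y) = (x <= y).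
Proof. by elim: n => //= n <-; rewrite shift_leE. Qed.

Lemma iter_shift_ge0 n x : (0 <= iter n S x) = (0 <= x).
Proof. by rewrite -{1}(iter_shift0 n) iter_shift_leE. Qed.

Lemma iter_shift_eq0 n x : iter n S x = 0 -> x = 0.
Proof. by elim: n => //= n ih /shift_eq0. Qed.

Lemma iter_shift_surj n y : exists x, iter n S x = y.
Proof.
elim: n y => [|n ih] y /=; first by exists y.
by have [z <-] := Ssurj y; have [x <-] := ih z; exists x.
Qed.

Lemma condexp_iter_shift n x : T (iter n S x) = T x.
Proof. by elim: n => //= n <-; rewrite (ceps_TS sys). Qed.

Context (p : E) (hp : component e p).

Let p_ge0 : 0 <= p. Proof. by case: hp => /andP[]. Qed.
Let p_le : p <= e. Proof. by case: hp => /andP[]. Qed.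

Fixpoint visited n : E :=
  if n is m.+1 then visited m \vee iter m S p else 0.

Definition newly_visited n : E := visited n.+1 - visited n.

Lemma visited_leS n : visited n <= visited n.+1.
Proof. exact: leUl_riesz. Qed.

Lemma visited_ge0 n : 0 <= visited n.
Proof. by elim: n => // n ih; exact: le_trans ih (visited_leS n). Qed.

Lemma iter_le_visited n m : (n < m)%N -> iter n S p <= visited m.
Proof.
elim: m => // m ih; rewrite ltnS leq_eqVlt => /orP[/eqP->|/ih nm].
  exact: leUr_riesz.
exact: le_trans nm (visited_leS m).
Qed.

Lemma visited_component n : component e (visited n).
Proof.
elim: n => [|n [/andP[u0 ue] uc]].
  split; first by rewrite lexx unit_ge0.
  by apply/riesz_meet_idPl; rewrite subr0 unit_ge0.
have se : iter n S p <= e by rewrite -(iter_shift_unit n) iter_shift_leE.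
have s0 : 0 <= iter n S p by rewrite iter_shift_ge0.
have sc : iter n S p \wedge (e - iter n S p) = 0.
  rewrite -{1}(iter_shift_unit n) -iter_shiftB -iter_shiftI (proj2 hp).
  exact: iter_shift0.
have ve : visited n.+1 <= e by rewrite riesz_leUx ue.
split; first by rewrite visited_ge0.
apply/le_anti; rewrite riesz_meet_ge0 ?visited_ge0 ?riesz_subr_ge0 // andbT.
apply: riesz_join_meet_le.
  apply: (@le_trans _ _ (visited n \wedge (e - visited n))); last by rewrite uc.
  apply: riesz_leI2 => //.
  by rewrite riesz_leD2lE riesz_leN2 leUl_riesz.
apply: (@le_trans _ _ (iter n S p \wedge (e - iter n S p))); last by rewrite sc.
apply: riesz_leI2 => //.
by rewrite riesz_leD2lE riesz_leN2 leUr_riesz.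
Qed.

Lemma visited_le n : visited n <= e.
Proof. by case: (visited_component n) => /andP[]. Qed.

Lemma newly_visited_ge0 n : 0 <= newly_visited n.
Proof. by rewrite riesz_subr_ge0 visited_leS. Qed.

Lemma newly_visited_le n : newly_visited n <= iter n S p.
Proof.
rewrite riesz_leBlDr riesz_leUx riesz_lerDl ?visited_ge0 // andbT addrC.
by rewrite riesz_lerDl ?iter_shift_ge0.
Qed.

Lemma visited_newly_disjoint n : visited n \wedge newly_visited n = 0.
Proof.
have [_ uc] := visited_component n.
apply: riesz_meet_eq0W uc; rewrite ?visited_ge0 ?newly_visited_ge0 //.
by rewrite /newly_visited ![_ - visited n]addrC riesz_leD2lE visited_le.
Qed.

Definition no_return_set n : set E := [set q | component p q /\
  forall j, (1 <= j <= n)%N -> p \wedge iter j S q = 0].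

Lemma no_return_setS n : no_return_set n.+1 `<=` no_return_set n.
Proof.
by move=> q [pq qj]; split=> // j /andP[j1 jn]; rewrite qj // j1 leqW.
Qed.

(** [S^n q] is disjoint from [S^k p] for [k < n], because the meet of the two is
    the image under [S^k] of the meet of [p] and [S^(n-k) q]. By finite
    distributivity it is disjoint from [visited n], so the sum of the two is
    their join. *)
Lemma iter_no_return_le n q :
  no_return_set n q -> iter n S q <= newly_visited n.
Proof.
move=> [[/andP[q0 qp] qc] qj].
have disj k : (k <= n)%N -> visited k \wedge iter n S q <= 0.
  elim: k => [_|k ih kn]; first exact: leIl_riesz.
  apply: riesz_join_meet_le; first exact/ih/ltnW.
  rewrite -{1}(subnKC (ltnW kn)) iterD -iter_shiftI qj ?iter_shift0 //.
  by rewrite subn_gt0 kn leq_subr.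
rewrite riesz_leBrDr -riesz_joinDmeet riesz_meetC.
rewrite -[X in _ <= X]addr0; apply: riesz_leD; last exact: disj.
rewrite riesz_leUx visited_leS.
by rewrite (le_trans _ (leUr_riesz _ _)) // iter_shift_leE.
Qed.

(** All conditions on [x] are reflected by powers of the injective shift:
    being a component of [p] by [S^n], and having no return at time [j] by
    [S^(n-j)], which sends [p] below [visited n] since [n - j < n]. *)
Lemma no_return_preimage n x :
  iter n S x = newly_visited n -> no_return_set n x.
Proof.
move=> xn.
have x0 : 0 <= x by rewrite -(iter_shift_ge0 n) xn newly_visited_ge0.
have xp : x <= p by rewrite -(iter_shift_leE n) xn newly_visited_le.
split.
  split; first by rewrite x0.
  apply: (@iter_shift_eq0 n); rewrite iter_shiftI iter_shiftB xn riesz_meetC.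
  apply: riesz_meet_eq0W (visited_newly_disjoint n);
    rewrite ?newly_visited_ge0 ?riesz_subr_ge0 ?newly_visited_le //.
  rewrite riesz_leBlDr /newly_visited addrC subrK; exact: leUr_riesz.
move=> j /andP[j1 jn].
apply: (@iter_shift_eq0 (n - j)); rewrite iter_shiftI -iterD subnK // xn.
apply: riesz_meet_eq0W (visited_newly_disjoint n);
  rewrite ?newly_visited_ge0 ?iter_shift_ge0 //.
by apply: iter_le_visited; rewrite ltn_subrL j1 (leq_trans j1).
Qed.

(** The supremum that defines [no_return S p n] is a maximum: it is attained at
    the preimage under [S^n] of the newly visited part. *)
Lemma no_returnP n : [/\ no_return_set n (no_return S p n),
  ubound (no_return_set n) (no_return S p n) &
  iter n S (no_return S p n) = newly_visited n].
Proof.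
have [r rn] := iter_shift_surj n (newly_visited n).
have rQ := no_return_preimage rn.
have rub : ubound (no_return_set n) r.
  by move=> q Qq; rewrite -(iter_shift_leE n) rn iter_no_return_le.
suff -> : no_return S p n = r by [].
case: n rn rQ rub => [|n] rn rQ rub; last exact: supremum_max.
have [[/andP[_ rp] _] _] := rQ.
apply/le_anti; rewrite rp andbT; apply: rub; split=> [|j]; last by case: j.
by split; rewrite ?p_ge0 ?lexx // subrr riesz_meetC; apply/riesz_meet_idPl.
Qed.

Lemma no_return_ge0 n : 0 <= no_return S p n.
Proof. by have [[[/andP[]]]] := no_returnP n. Qed.

Lemma no_return_leS n : no_return S p n.+1 <= no_return S p n.
Proof.
have [_ ub _] := no_returnP n; have [Q _ _] := no_returnP n.+1.
exact/ub/no_return_setS.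
Qed.

Definition no_return_sum n : E := \sum_(i < n) no_return S p i.

Lemma no_return_sumS n :
  no_return_sum n.+1 = no_return_sum n + no_return S p n.
Proof. by rewrite /no_return_sum big_ord_recr. Qed.

Lemma no_return_sum_leS n : no_return_sum n <= no_return_sum n.+1.
Proof. by rewrite no_return_sumS riesz_lerDl ?no_return_ge0. Qed.

Lemma no_return_sum_ge0 n : 0 <= no_return_sum n.
Proof.
elim: n => [|n ih]; first by rewrite /no_return_sum big_ord0.
exact: le_trans ih (no_return_sum_leS n).
Qed.

Lemma condexp_no_return_sum n : T (no_return_sum n) = T (visited n).
Proof.
elim: n => [|n ih]; first by rewrite /no_return_sum big_ord0.
rewrite no_return_sumS raddfD /= ih -(condexp_iter_shift n (no_return S p n)).
by have [_ _ ->] := no_returnP n; rewrite -raddfD /= addrC subrK.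
Qed.

Lemma recurrence_partialE m :
  recurrence_partial S p m = no_return_sum m - no_return S p m *+ m.
Proof.
elim: m => [|m ih].
  by rewrite /recurrence_partial /no_return_sum big_geq // big_ord0 subr0.
rewrite /recurrence_partial big_nat_recr //= -/(recurrence_partial S p m) ih.
rewrite no_return_sumS mulrnBl addrA; congr (_ - _).
by rewrite mulrSr addrA subrK.
Qed.

(** In terms of the partial sums [n_k] of the series of [n_p], this says that
    [no_return_sum m] exceeds [n_(m+j)] by at most [m] copies of
    [no_return S p (m + j)]. *)
Lemma no_return_sum_tail m j :
  no_return_sum m + no_return S p (m + j) *+ j <= no_return_sum (m + j).
Proof.
elim: j => [|j ih]; first by rewrite mulr0n addr0 addn0.
rewrite addnS no_return_sumS mulrSr addrA riesz_leD ?no_return_leS //.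
by rewrite (le_trans _ ih) // riesz_leD2lE riesz_lerMn ?no_return_leS.
Qed.

(** The two sequences differ by multiples of [no_return S p]. Let [b] bound
    the partial sums and put [d = no_return_sum m - b]. Then
    [d <= no_return S p (m + j) *+ m] for every [j], while
    [no_return S p (m + j) *+ j <= a]. Hence [d *+ j <= a *+ m] for all [j], and
    [d <= 0] because the space is Archimedean. *)
Lemma sup_recurrence_partial a : supremums (range no_return_sum) a ->
  supremums (range (recurrence_partial S p)) a.
Proof.
move=> [uba luba]; have Na n : no_return_sum n <= a by apply: uba; exists n.
split=> [_ [m _ <-]|b ubb].
  rewrite recurrence_partialE riesz_leBlDr (le_trans (Na m)) // riesz_lerDl //.
  by rewrite riesz_mulrn_ge0 ?no_return_ge0.
apply: luba => _ [m _ <-].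
rewrite -[b]add0r -riesz_leBlDr.
apply: (@riesz_archimedean _ _ _ (a *+ m)); first exact: ceps_complete sys.
move=> j.
have dm : no_return_sum m - b <= no_return S p (m + j) *+ m.
  rewrite riesz_leBlDr addrC -riesz_leBlDr.
  apply: (@le_trans _ _ (recurrence_partial S p (m + j))).
    rewrite recurrence_partialE mulrnDr opprD addrA addrAC.
    rewrite riesz_leD // riesz_leBrDr; exact: no_return_sum_tail.
  by apply: ubb; exists (m + j)%N.
apply: (le_trans (riesz_lerMn j dm)); rewrite mulrnAC; apply: riesz_lerMn.
apply: le_trans (Na (m + j)); apply: le_trans (no_return_sum_tail m j).
by rewrite addrC riesz_lerDl ?no_return_sum_ge0.
Qed.

(** A surjective shift is an order isomorphism, so it preserves the supremum
    [U]; as it moves [visited n] into [visited n.+1], this gives [S U <= U].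
    The difference has expectation zero. *)
Lemma sup_visited_invariant U : supremums (range visited) U -> S U = U.
Proof.
move=> [ubU lubU].
have SU : S U <= U.
  have [V VU] := Ssurj U; rewrite -{2}VU shift_leE; apply: lubU => _ [n _ <-].
  rewrite -shift_leE VU.
  apply: (@le_trans _ _ (visited n.+1)); last by apply: ubU; exists n.+1.
  elim: n => [|n ih]; first by rewrite raddf0 visited_ge0.
  rewrite /= (proj1 (ceps_Shom sys)) riesz_leUx.
  by rewrite (le_trans ih (visited_leS _)) leUr_riesz.
apply/esym/subr0_eq/Tpos; first by rewrite riesz_subr_ge0.
by rewrite raddfB /= (ceps_TS sys) subrr.
Qed.

(** A component of the unit that [T] fixes is also kept by the shift: [S w] and
    [e - w] have expectations [w] and [e - w], which are disjoint. *)
Lemma condexp_fixed_shift w : 0 <= w <= e -> w \wedge (e - w) = 0 -> T w = w ->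
  S w <= w.
Proof.
move=> /andP[w0 we] wc Tw.
have Sw0 : 0 <= S w by have := iter_shift_ge0 1 w; rewrite /= => ->.
rewrite -[X in _ <= X](subKr e); apply: riesz_disjoint_leB.
- apply: condexp_disjoint => //; first by rewrite riesz_subr_ge0.
  by rewrite (ceps_TS sys) raddfB /= (ceps_Te sys) Tw.
- by rewrite -(ceps_Se sys) shift_leE.
- by rewrite riesz_leBlDr riesz_lerDl.
Qed.

(** The terms [x *+ n \wedge e] stay in the range of [T], which is a Riesz
    subspace, so [T] fixes them, and order continuity passes to the supremum. *)
Lemma condexp_sup_meet_unit x w : T x = x ->
  supremums (range (fun n => x *+ n \wedge e)) w -> 0 <= x -> T w = w.
Proof.
move=> Tx supw x0.
have [_ Tc TT [[F0 FD FZ _ FI] _] _] := ceps_condexp sys.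
have TwE : T \o (fun n => x *+ n \wedge e) = (fun n => x *+ n \wedge e).
  apply/funext => n /=.
  have [z _ <-] : range T (x *+ n \wedge e).
    apply: FI; last by exists e; rewrite ?(ceps_Te sys).
    by exists (x *+ n); rewrite ?raddfMn //= Tx.
  exact: TT.
apply: is_subset1_supremums (supw); rewrite -{1}TwE.
apply: order_continuous_sup => //; first exact: condexp_ge0.
by move=> n; apply: riesz_leI2 => //; rewrite mulrSr riesz_lerDl.
Qed.

Lemma sup_visited_band_proj U : conditionally_ergodic T S ->
  supremums (range visited) U -> T U = U /\ band_proj (T p) e = U.
Proof.
move=> erg supU; have [ubU lubU] := supU.
have [_ _ TT _ _] := ceps_condexp sys.
have TU : T U = U.
  by have [|z _ <-] := erg U; [exact: sup_visited_invariant|exact: TT].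
have Ue : U <= e by apply: lubU => _ [n _ <-]; exact: visited_le.
have U0 : 0 <= U by apply: ubU; exists 0%N.
have eU0 : 0 <= e - U by rewrite riesz_subr_ge0.
have e0 := unit_ge0; have Tp0 := condexp_ge0 p_ge0.
split=> //; apply: band_proj_eq; last first.
  have Uc : U \wedge (e - U) = 0.
    apply/le_anti; rewrite riesz_meet_ge0 // andbT.
    apply: (riesz_sup_meet_le supU) => _ [n _ <-].
    have [_ <-] := visited_component n; apply: riesz_leI2 => //.
    by rewrite riesz_leD2lE riesz_leN2; apply: ubU; exists n.
  move=> y; apply: riesz_band_gen_disjoint => //.
  apply: riesz_meet_eq0W Uc => //; rewrite -TU; apply: condexp_le.
  by apply: le_trans (ubU (visited 1) _); [exact: leUr_riesz|exists 1%N].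
have [|w supw] := ceps_complete sys (A := range (fun n => T p *+ n \wedge e)).
  split; first by exists (T p *+ 0 \wedge e), 0%N.
  by exists e => _ [n _ <-]; exact: leIr_riesz.
have [Tpw wc /andP[w0 we]] := sup_meet_unit_component Tp0 e0 supw.
have Tw : T w = w by apply: condexp_sup_meet_unit supw _.
apply: (band_gen_le Tp0 supw e0); rewrite U0; apply: lubU => _ [n _ <-].
have itw k : iter k S p <= w.
  elim: k => [|k ih] /=; last first.
    apply: le_trans (condexp_fixed_shift _ wc Tw); last by rewrite w0.
    by rewrite shift_leE.
  rewrite -[X in _ <= X](subKr e); apply: riesz_disjoint_leB => //.
    apply: condexp_disjoint => //; first by rewrite riesz_subr_ge0.
    by rewrite raddfB /= (ceps_Te sys) Tw.
  by rewrite riesz_leBlDr riesz_lerDl.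
by elim: n => // n ih; rewrite riesz_leUx ih itw.
Qed.

End Recurrence.

Theorem corollary4p5 (R : realType) (E : rieszType R) (T S : {linear E -> E})
  (e : E)
  (sys : cond_exp_preserving_system T S e)
  (erg : conditionally_ergodic T S)
  (Tpos : strictly_positive T)
  (Tuniv : T_universally_complete T)
  (Ssurj : forall y : E, exists x : E, S x = y)
  (p : E) (hp : component e p) :
  supremums (range (recurrence_partial S p)) (first_recurrence S p) /\
  T (first_recurrence S p) = band_proj (T p) e.
Proof.
have [U supU] : supremums (range (visited S p)) !=set0.
  apply: (ceps_complete sys); split; first by exists 0, 0%N.
  by exists e => _ [n _ <-]; exact: (visited_le sys).
have [TU ->] := sup_visited_band_proj sys Tpos Ssurj hp erg supU.
have [T0 Tc _ _ _] := ceps_condexp sys.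
have sumS := no_return_sum_leS sys Tpos Ssurj hp.
have visS := @visited_leS _ _ S p.
have ATU : T \o no_return_sum S p = T \o visited S p.
  by apply/funext => n; exact: (condexp_no_return_sum sys Tpos Ssurj hp).
have [a Aa] : exists a,
    order_cvg (fun m n : nat => (m <= n)%N) (no_return_sum S p) a.
  apply: Tuniv.
  - exact: directed_nat.
  - exact: increasing_netS.
  - exact: (no_return_sum_ge0 sys Tpos Ssurj hp).
  rewrite ATU; exists e => _ [n _ <-]; rewrite -(ceps_Te sys).
  by apply: positive_le T0 _ _ _; exact: (visited_le sys).
have supA := order_cvg_sup (increasing_netS sumS) Aa.
have supN := sup_recurrence_partial sys Tpos Ssurj hp supA.
have -> : first_recurrence S p = a.
  by apply: supremum_eq supN; exists (recurrence_partial S p 0), 0%N.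
split=> //; rewrite -[RHS]TU.
apply: is_subset1_supremums (order_continuous_sup T0 Tc visS supU).
by rewrite -ATU; exact: order_continuous_sup.
Qed.
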